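(* Let $N\geq1$, let $q\in\mathbb{C}^*$, and let $\xi$ be a diagonal $N\times N$ matrix with complex entries. Then the image of $\beta^\xi$ is contained in $\mathcal{O}(D\setminus GL_q)$. Similarly, $\mathrm{im}(\alpha^\xi)\subseteq\mathcal{O}(D\setminus GL_q)$.
   Context: $\mathcal{O}(M_q)$ is the unital associative $\mathbb{C}$-algebra generated by $x_{ij}$, $1\le i,j\le N$, subject to the relations $x_{ij}x_{il}=qx_{il}x_{ij}$, $x_{ij}x_{kj}=qx_{kj}x_{ij}$, $x_{il}x_{kj}=x_{kj}x_{il}$, $x_{ij}x_{kl}-x_{kl}x_{ij}=(q-q^{-1})x_{il}x_{kj}$ whenever $i<k$ and $j<l$ (for the indices occurring in the relation). It is a bialgebra with $\Delta(x_{ij})=\sum_k x_{ik}\otimes x_{kj}$, $\varepsilon(x_{ij})=\delta_{ij}$. The quantum determinant $\det_q=\sum_{\sigma\in S_N}(-q)^{l(\sigma)}x_{1,\sigma(1)}\cdots x_{N,\sigma(N)}$ ($l(\sigma)$ the number of inversions) is central, and $\mathcal{O}(GL_q)=\mathcal{O}(M_q)[\det_q^{-1}]$ is a Hopf algebra with comultiplication $\Delta$ and antipode $S$. In Sweedler notation, define the right coactions $\beta,\alpha:\mathcal{O}(M_q)\to\mathcal{O}(M_q)\otimes\mathcal{O}(GL_q)$ by $\beta(h)=\sum h_2\otimes S(h_1)h_3$ and $\alpha(h)=\sum h_2\otimes h_3S(h_1)$. A diagonal matrix $\xi$ determines the algebra homomorphism $\mathrm{ev}_\xi:\mathcal{O}(M_q)\to\mathbb{C}$,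 $x_{ij}\mapsto\xi_{ij}$. The co-orbit maps are the linear maps $\beta^\xi=(\mathrm{ev}_\xi\otimes\mathrm{id})\circ\beta$ and $\alpha^\xi=(\mathrm{ev}_\xi\otimes\mathrm{id})\circ\alpha$ from $\mathcal{O}(M_q)$ to $\mathcal{O}(GL_q)$. Let $\mathcal{O}(D)=\mathbb{C}[t_1^{\pm1},\ldots,t_N^{\pm1}]$ be the Hopf algebra with $\Delta(t_i)=t_i\otimes t_i$, $\varepsilon(t_i)=1$; let $\pi_D:\mathcal{O}(GL_q)\to\mathcal{O}(D)$ be the Hopf algebra homomorphism $x_{ij}\mapsto\delta_{ij}t_i$, and $\lambda_D=(\pi_D\otimes\mathrm{id})\circ\Delta$ the corresponding left coaction of $\mathcal{O}(D)$ on $\mathcal{O}(GL_q)$. Then $\mathcal{O}(D\setminus GL_q)=\{f\in\mathcal{O}(GL_q)\mid\lambda_D(f)=1\otimes f\}$. *)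

(* Defs.v *)
From HB Require Import structures.
From mathcomp Require Import all_boot all_order perm all_algebra.
From mathcomp Require Import boolp classical_sets reals.
From mathcomp Require Import complex.

Set Implicit Arguments.
Unset Strict Implicit.
Unset Printing Implicit Defensive.

Import GRing.Theory.

Local Open Scope ring_scope.
Local Open Scope quotient_scope.

Inductive aterm (F I : Type) : Type :=
| Gen of I
| Cst of F
| Add of aterm F I & aterm F I
| Mul of aterm F I & aterm F I.
Arguments Gen {F I}.
Arguments Cst {F I}.

HB.instance Definition _ F I := gen_eqMixin (aterm F I).
HB.instance Definition _ F I := gen_choiceMixin (aterm F I).

Declare Scope aterm_scope.
Delimit Scope aterm_scope with AT.
Bind Scope aterm_scope with aterm.
Infix "+" := Add : aterm_scope.
Infix "*" := Mul : aterm_scope.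
Notation "- t" := (Mul (Cst (-1)%R) t) : aterm_scope.
Notation "s - t" := (Add s (Mul (Cst (-1)%R) t)) : aterm_scope.

(* The least congruence that contains the relations [r] and makes the quotient
   an associative unital [F]-algebra. *)
Inductive cong (F : fieldType) (I : Type) (r : aterm F I -> aterm F I -> Prop) :
  aterm F I -> aterm F I -> Prop :=
| cong_rel s t : r s t -> cong r s t
| cong_refl t : cong r t t
| cong_sym s t : cong r s t -> cong r t s
| cong_trans s t u : cong r s t -> cong r t u -> cong r s u
| cong_add s s' t t' : cong r s s' -> cong r t t' -> cong r (s + t) (s' + t')
| cong_mul s s' t t' : cong r s s' -> cong r t t' -> cong r (s * t) (s' * t')
| cong_addA s t u : cong r (s + (t + u)) ((s + t) + u)
| cong_addC s t : cong r (s + t) (t + s)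
| cong_add0 t : cong r (Cst 0%R + t) t
| cong_addN t : cong r (- t + t) (Cst 0%R)
| cong_mulA s t u : cong r (s * (t * u)) ((s * t) * u)
| cong_mul1 t : cong r (Cst 1%R * t) t
| cong_mulDl s t u : cong r ((s + t) * u) (s * u + t * u)
| cong_mulDr s t u : cong r (s * (t + u)) (s * t + s * u)
| cong_cstD a b : cong r (Cst (a + b)%R) (Cst a + Cst b)
| cong_cstM a b : cong r (Cst (a * b)%R) (Cst a * Cst b)
| cong_cstC a t : cong r (Cst a * t) (t * Cst a).

Section Presented.
Variables (F : fieldType) (I : Type) (r : aterm F I -> aterm F I -> Prop).

Definition congb (s t : aterm F I) : bool := `[< cong r s t >].

Lemma congb_refl : reflexive congb.
Proof. by move=> t; apply/asboolP; exact: cong_refl. Qed.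
Lemma congb_sym : symmetric congb.
Proof. by move=> s t; apply/asboolP/asboolP; exact: cong_sym. Qed.
Lemma congb_trans : transitive congb.
Proof.
move=> t s u /asboolP st /asboolP tu; apply/asboolP.
exact: cong_trans st tu.
Qed.

Canonical congb_equiv := EquivRel congb congb_refl congb_sym congb_trans.

Definition presAlg := {eq_quot congb_equiv}.
HB.instance Definition _ := Choice.on presAlg.
HB.instance Definition _ := EqQuotient.on presAlg.

Definition cls (t : aterm F I) : presAlg := \pi_presAlg t.

Lemma clsP s t : cls s = cls t <-> cong r s t.
Proof.
by split=> [/eqmodP/asboolP|st]; last exact/eqmodP/asboolP.
Qed.

Lemma clsW (P : presAlg -> Prop) : (forall t, P (cls t)) -> forall x, P x.
Proof. by move=> Pc x; elim/quotW: x => t; exact: Pc. Qed.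

Lemma cong_repr t : cong r (repr (cls t)) t.
Proof. by apply/clsP; rewrite /cls reprK. Qed.

Definition pr_add (x y : presAlg) := cls (repr x + repr y)%AT.
Definition pr_mul (x y : presAlg) := cls (repr x * repr y)%AT.
Definition pr_opp (x : presAlg) := cls (- repr x)%AT.
Definition pr_scale (a : F) (x : presAlg) := cls (Cst a * repr x)%AT.

Lemma pr_addE s t : pr_add (cls s) (cls t) = cls (s + t)%AT.
Proof. by apply/clsP; apply: cong_add; exact: cong_repr. Qed.
Lemma pr_mulE s t : pr_mul (cls s) (cls t) = cls (s * t)%AT.
Proof. by apply/clsP; apply: cong_mul; exact: cong_repr. Qed.
Lemma pr_oppE t : pr_opp (cls t) = cls (- t)%AT.
Proof.
by apply/clsP; apply: cong_mul; [exact: cong_refl | exact: cong_repr].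
Qed.
Lemma pr_scaleE a t : pr_scale a (cls t) = cls (Cst a * t)%AT.
Proof.
by apply/clsP; apply: cong_mul; [exact: cong_refl | exact: cong_repr].
Qed.

Lemma pr_addA : associative pr_add.
Proof.
elim/clsW=> s; elim/clsW=> t; elim/clsW=> u.
by rewrite !pr_addE; apply/clsP; exact: cong_addA.
Qed.
Lemma pr_addC : commutative pr_add.
Proof.
elim/clsW=> s; elim/clsW=> t.
by rewrite !pr_addE; apply/clsP; exact: cong_addC.
Qed.
Lemma pr_add0 : left_id (cls (Cst 0)) pr_add.
Proof. by elim/clsW=> t; rewrite pr_addE; apply/clsP; exact: cong_add0. Qed.
Lemma pr_addN : left_inverse (cls (Cst 0)) pr_opp pr_add.
Proof.
by elim/clsW=> t; rewrite pr_oppE pr_addE; apply/clsP; exact: cong_addN.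
Qed.
Lemma pr_mulA : associative pr_mul.
Proof.
elim/clsW=> s; elim/clsW=> t; elim/clsW=> u.
by rewrite !pr_mulE; apply/clsP; exact: cong_mulA.
Qed.
Lemma pr_mul1 : left_id (cls (Cst 1)) pr_mul.
Proof. by elim/clsW=> t; rewrite pr_mulE; apply/clsP; exact: cong_mul1. Qed.
Lemma pr_mulr1 : right_id (cls (Cst 1)) pr_mul.
Proof.
elim/clsW=> t; rewrite pr_mulE -[RHS]pr_mul1 pr_mulE; apply/clsP.
exact/cong_sym/cong_cstC.
Qed.
Lemma pr_mulDl : left_distributive pr_mul pr_add.
Proof.
elim/clsW=> s; elim/clsW=> t; elim/clsW=> u.
by rewrite !(pr_addE, pr_mulE); apply/clsP; exact: cong_mulDl.
Qed.
Lemma pr_mulDr : right_distributive pr_mul pr_add.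
Proof.
elim/clsW=> s; elim/clsW=> t; elim/clsW=> u.
by rewrite !(pr_addE, pr_mulE); apply/clsP; exact: cong_mulDr.
Qed.

HB.instance Definition _ :=
  GRing.isZmodule.Build presAlg pr_addA pr_addC pr_add0 pr_addN.
HB.instance Definition _ :=
  GRing.Zmodule_isPzRing.Build presAlg pr_mulA pr_mul1 pr_mulr1 pr_mulDl pr_mulDr.

Lemma clsD s t : cls (s + t)%AT = cls s + cls t. Proof. by rewrite -pr_addE. Qed.
Lemma clsM s t : cls (s * t)%AT = cls s * cls t. Proof. by rewrite -pr_mulE. Qed.
Lemma cls0 : cls (Cst 0) = 0. Proof. by []. Qed.
Lemma cls1 : cls (Cst 1) = 1. Proof. by []. Qed.

Lemma pr_scaleM a x : pr_scale a x = cls (Cst a) * x.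
Proof. by elim/clsW: x => t; rewrite pr_scaleE clsM. Qed.
Lemma cls_cstD a b : cls (Cst (a + b)) = cls (Cst a) + cls (Cst b).
Proof. by rewrite -clsD; apply/clsP; exact: cong_cstD. Qed.
Lemma cls_cstM a b : cls (Cst (a * b)) = cls (Cst a) * cls (Cst b).
Proof. by rewrite -clsM; apply/clsP; exact: cong_cstM. Qed.

Lemma pr_scaleA a b x : pr_scale a (pr_scale b x) = pr_scale (a * b) x.
Proof. by rewrite !pr_scaleM cls_cstM mulrA. Qed.
Lemma pr_scale1 : left_id 1 pr_scale.
Proof. by move=> x; rewrite pr_scaleM mul1r. Qed.
Lemma pr_scaleDr : right_distributive pr_scale +%R.
Proof. by move=> a x y; rewrite !pr_scaleM mulrDr. Qed.
Lemma pr_scaleDl x : {morph pr_scale^~ x : a b / a + b}.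
Proof. by move=> a b; rewrite !pr_scaleM cls_cstD mulrDl. Qed.

HB.instance Definition _ :=
  GRing.Zmodule_isLmodule.Build F presAlg
    pr_scaleA pr_scale1 pr_scaleDr pr_scaleDl.

Lemma presZ a (x : presAlg) : a *: x = cls (Cst a) * x.
Proof. exact: pr_scaleM. Qed.
Lemma cls_cst a : cls (Cst a) = a *: (1 : presAlg). Proof. by rewrite presZ mulr1. Qed.
Lemma presZAl a (x y : presAlg) : a *: (x * y) = (a *: x) * y.
Proof. by rewrite !presZ mulrA. Qed.
Lemma presZAr a (x y : presAlg) : a *: (x * y) = x * (a *: y).
Proof.
rewrite !presZ !mulrA; congr (_ * _).
by elim/clsW: x => t; rewrite -!clsM; apply/clsP; exact: cong_cstC.
Qed.

Section Lift.
Variables (B : algType F) (g : I -> B).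

Fixpoint teval (t : aterm F I) : B :=
  match t with
  | Gen i => g i
  | Cst a => a%:A
  | (s + t)%AT => teval s + teval t
  | (s * t)%AT => teval s * teval t
  end.

Hypothesis gP : forall s t, r s t -> teval s = teval t.

Lemma teval_cong s t : cong r s t -> teval s = teval t.
Proof.
elim=> //= {s t}.
- by move=> s t u _ -> _ ->.
- by move=> s s' t t' _ -> _ ->.
- by move=> s s' t t' _ -> _ ->.
- by move=> s t u; rewrite addrA.
- by move=> s t; rewrite addrC.
- by move=> t; rewrite scale0r add0r.
- by move=> t; rewrite -scalerAl mul1r scaleN1r addNr scale0r.
- by move=> s t u; rewrite mulrA.
- by move=> t; rewrite scale1r mul1r.
- by move=> s t u; rewrite mulrDl.
- by move=> s t u; rewrite mulrDr.
- by move=> a b; rewrite scalerDl.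
- by move=> a b; rewrite -scalerAl mul1r scalerA.
- by move=> a t; rewrite -scalerAl -scalerAr mul1r mulr1.
Qed.

Definition pres_lift (_ : forall s t, r s t -> teval s = teval t)
  (x : presAlg) : B := teval (repr x).

Lemma pres_lift_cls t : pres_lift gP (cls t) = teval t.
Proof. exact/teval_cong/cong_repr. Qed.

Lemma pres_lift_linear : linear (pres_lift gP).
Proof.
move=> a; elim/clsW=> s; elim/clsW=> t.
by rewrite presZ -clsM -clsD !pres_lift_cls /= -scalerAl mul1r.
Qed.

Lemma pres_lift_monoid : monoid_morphism (pres_lift gP).
Proof.
split; first by rewrite -cls1 pres_lift_cls /= scale1r.
by elim/clsW=> s; elim/clsW=> t; rewrite -clsM !pres_lift_cls.
Qed.
End Lift.

Lemma pres_neq0 (B : algType F) (g : I -> B) :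
  (forall s t, r s t -> teval g s = teval g t) -> (1 : presAlg) != 0.
Proof.
move=> gP; apply/eqP => /(congr1 (pres_lift gP)).
rewrite -cls1 -cls0 !pres_lift_cls /= scale1r scale0r => /eqP.
by rewrite oner_eq0.
Qed.

End Presented.

Inductive tterm (F V W : Type) : Type :=
| TPure of V & W
| TZero
| TOpp of tterm F V W
| TAdd of tterm F V W & tterm F V W
| TScale of F & tterm F V W.
Arguments TPure {F V W}.
Arguments TZero {F V W}.
Arguments TOpp {F V W}.
Arguments TAdd {F V W}.
Arguments TScale {F V W}.

HB.instance Definition _ F V W := gen_eqMixin (tterm F V W).
HB.instance Definition _ F V W := gen_choiceMixin (tterm F V W).

(* The least congruence for which the quotient is an [F]-module and [TPure] is
   bilinear. *)
Inductive tcong (F : fieldType) (V W : lmodType F) :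
  tterm F V W -> tterm F V W -> Prop :=
| tcong_pureDl v v' w : tcong (TPure (v + v') w) (TAdd (TPure v w) (TPure v' w))
| tcong_pureDr v w w' : tcong (TPure v (w + w')) (TAdd (TPure v w) (TPure v w'))
| tcong_pureZl a v w : tcong (TPure (a *: v) w) (TScale a (TPure v w))
| tcong_pureZr a v w : tcong (TPure v (a *: w)) (TScale a (TPure v w))
| tcong_refl t : tcong t t
| tcong_sym s t : tcong s t -> tcong t s
| tcong_trans s t u : tcong s t -> tcong t u -> tcong s u
| tcong_opp s s' : tcong s s' -> tcong (TOpp s) (TOpp s')
| tcong_add s s' t t' : tcong s s' -> tcong t t' -> tcong (TAdd s t) (TAdd s' t')
| tcong_scale a s s' : tcong s s' -> tcong (TScale a s) (TScale a s')
| tcong_addA s t u : tcong (TAdd s (TAdd t u)) (TAdd (TAdd s t) u)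
| tcong_addC s t : tcong (TAdd s t) (TAdd t s)
| tcong_add0 t : tcong (TAdd TZero t) t
| tcong_addN t : tcong (TAdd (TOpp t) t) TZero
| tcong_scaleA a b t : tcong (TScale a (TScale b t)) (TScale (a * b) t)
| tcong_scale1 t : tcong (TScale 1 t) t
| tcong_scaleDr a s t : tcong (TScale a (TAdd s t)) (TAdd (TScale a s) (TScale a t))
| tcong_scaleDl a b t : tcong (TScale (a + b) t) (TAdd (TScale a t) (TScale b t)).

Section Tensor.
Variables (F : fieldType) (V W : lmodType F).

Definition tcongb (s t : tterm F V W) : bool := `[< tcong s t >].

Lemma tcongb_refl : reflexive tcongb.
Proof. by move=> t; apply/asboolP; exact: tcong_refl. Qed.
Lemma tcongb_sym : symmetric tcongb.
Proof. by move=> s t; apply/asboolP/asboolP; exact: tcong_sym. Qed.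
Lemma tcongb_trans : transitive tcongb.
Proof.
move=> t s u /asboolP st /asboolP tu; apply/asboolP.
exact: tcong_trans st tu.
Qed.

Canonical tcongb_equiv := EquivRel tcongb tcongb_refl tcongb_sym tcongb_trans.

Definition tensor := {eq_quot tcongb_equiv}.
HB.instance Definition _ := Choice.on tensor.
HB.instance Definition _ := EqQuotient.on tensor.

Definition tcls (t : tterm F V W) : tensor := \pi_tensor t.

Lemma tclsP s t : tcls s = tcls t <-> tcong s t.
Proof.
by split=> [/eqmodP/asboolP|st]; last exact/eqmodP/asboolP.
Qed.

Lemma tclsW (P : tensor -> Prop) : (forall t, P (tcls t)) -> forall x, P x.
Proof. by move=> Pc x; elim/quotW: x => t; exact: Pc. Qed.

Lemma tcong_repr t : tcong (repr (tcls t)) t.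
Proof. by apply/tclsP; rewrite /tcls reprK. Qed.

Definition ts_add (x y : tensor) := tcls (TAdd (repr x) (repr y)).
Definition ts_opp (x : tensor) := tcls (TOpp (repr x)).
Definition ts_scale (a : F) (x : tensor) := tcls (TScale a (repr x)).

Lemma ts_addE s t : ts_add (tcls s) (tcls t) = tcls (TAdd s t).
Proof. by apply/tclsP; apply: tcong_add; exact: tcong_repr. Qed.
Lemma ts_oppE t : ts_opp (tcls t) = tcls (TOpp t).
Proof. by apply/tclsP; apply: tcong_opp; exact: tcong_repr. Qed.
Lemma ts_scaleE a t : ts_scale a (tcls t) = tcls (TScale a t).
Proof. by apply/tclsP; apply: tcong_scale; exact: tcong_repr. Qed.

Lemma ts_addA : associative ts_add.
Proof.
elim/tclsW=> s; elim/tclsW=> t; elim/tclsW=> u.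
by rewrite !ts_addE; apply/tclsP; exact: tcong_addA.
Qed.
Lemma ts_addC : commutative ts_add.
Proof.
elim/tclsW=> s; elim/tclsW=> t.
by rewrite !ts_addE; apply/tclsP; exact: tcong_addC.
Qed.
Lemma ts_add0 : left_id (tcls TZero) ts_add.
Proof. by elim/tclsW=> t; rewrite ts_addE; apply/tclsP; exact: tcong_add0. Qed.
Lemma ts_addN : left_inverse (tcls TZero) ts_opp ts_add.
Proof.
by elim/tclsW=> t; rewrite ts_oppE ts_addE; apply/tclsP; exact: tcong_addN.
Qed.
HB.instance Definition _ :=
  GRing.isZmodule.Build tensor ts_addA ts_addC ts_add0 ts_addN.

Lemma tclsD s t : tcls (TAdd s t) = tcls s + tcls t.
Proof. by rewrite -ts_addE. Qed.

Lemma ts_scaleA a b x : ts_scale a (ts_scale b x) = ts_scale (a * b) x.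
Proof.
by elim/tclsW: x => t; rewrite !ts_scaleE; apply/tclsP; exact: tcong_scaleA.
Qed.
Lemma ts_scale1 : left_id 1 ts_scale.
Proof.
by elim/tclsW=> t; rewrite ts_scaleE; apply/tclsP; exact: tcong_scale1.
Qed.
Lemma ts_scaleDr : right_distributive ts_scale +%R.
Proof.
move=> a; elim/tclsW=> s; elim/tclsW=> t.
by rewrite -tclsD !ts_scaleE -tclsD; apply/tclsP; exact: tcong_scaleDr.
Qed.
Lemma ts_scaleDl x : {morph ts_scale^~ x : a b / a + b}.
Proof.
elim/tclsW: x => t a b.
by rewrite !ts_scaleE -tclsD; apply/tclsP; exact: tcong_scaleDl.
Qed.
HB.instance Definition _ :=
  GRing.Zmodule_isLmodule.Build F tensor
    ts_scaleA ts_scale1 ts_scaleDr ts_scaleDl.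

Lemma tclsN t : tcls (TOpp t) = - tcls t. Proof. by rewrite -ts_oppE. Qed.
Lemma tclsZ a t : tcls (TScale a t) = a *: tcls t.
Proof. by rewrite -ts_scaleE. Qed.

Definition tpure (v : V) (w : W) : tensor := tcls (TPure v w).

Lemma tpureDl v v' w : tpure (v + v') w = tpure v w + tpure v' w.
Proof. by rewrite -tclsD; apply/tclsP; exact: tcong_pureDl. Qed.
Lemma tpureDr v w w' : tpure v (w + w') = tpure v w + tpure v w'.
Proof. by rewrite -tclsD; apply/tclsP; exact: tcong_pureDr. Qed.
Lemma tpureZl a v w : tpure (a *: v) w = a *: tpure v w.
Proof. by rewrite -tclsZ; apply/tclsP; exact: tcong_pureZl. Qed.
Lemma tpureZr a v w : tpure v (a *: w) = a *: tpure v w.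
Proof. by rewrite -tclsZ; apply/tclsP; exact: tcong_pureZr. Qed.

Lemma tensor_ind (P : tensor -> Prop) :
  (forall v w, P (tpure v w)) -> (forall x y, P x -> P y -> P (x + y)) ->
  (forall a x, P x -> P (a *: x)) -> forall x, P x.
Proof.
move=> Pp PD PZ; elim/tclsW; elim=> [v w||t Pt|s Ps t Pt|a t Pt].
- exact: Pp.
- by have := PZ 0 _ (Pp 0 0); rewrite scale0r.
- by rewrite tclsN -scaleN1r; exact: PZ.
- by rewrite tclsD; exact: PD.
- by rewrite tclsZ; exact: PZ.
Qed.

Definition bilin (U : lmodType F) (f : V -> W -> U) : Prop :=
  (forall w, linear (f^~ w)) /\ (forall v, linear (f v)).

Lemma tpure_bilin : bilin tpure.
Proof.
by split=> [w a v v'|v a w w']; rewrite ?tpureDl ?tpureZl ?tpureDr ?tpureZr.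
Qed.

Section Lift.
Variables (U : lmodType F) (f : V -> W -> U).

Fixpoint tteval (t : tterm F V W) : U :=
  match t with
  | TPure v w => f v w
  | TZero => 0
  | TOpp t => - tteval t
  | TAdd s t => tteval s + tteval t
  | TScale a t => a *: tteval t
  end.

Definition tlift (_ : bilin f) (x : tensor) : U := tteval (repr x).

Variable fP : bilin f.

Lemma tteval_cong s t : tcong s t -> tteval s = tteval t.
Proof.
have [fl fr] := fP.
elim=> //= {s t}.
- by move=> v v' w; have:= fl w 1 v v'; rewrite !scale1r.
- by move=> v w w'; have:= fr v 1 w w'; rewrite !scale1r.
- move=> a v w; have f0 : f 0 w = 0.
    by have /eqP := fl w (-1) 0 0; rewrite scaler0 addr0 scaleN1r addNr => /eqP.
  by have:= fl w a v 0; rewrite /= f0 !addr0.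
- move=> a v w; have f0 : f v 0 = 0.
    by have /eqP := fr v (-1) 0 0; rewrite scaler0 addr0 scaleN1r addNr => /eqP.
  by have:= fr v a w 0; rewrite /= f0 !addr0.
- by move=> s t u _ -> _ ->.
- by move=> s s' _ ->.
- by move=> s s' t t' _ -> _ ->.
- by move=> a s s' _ ->.
- by move=> s t u; rewrite addrA.
- by move=> s t; rewrite addrC.
- by move=> t; rewrite add0r.
- by move=> t; rewrite addNr.
- by move=> a b t; rewrite scalerA.
- by move=> t; rewrite scale1r.
- by move=> a s t; rewrite scalerDr.
- by move=> a b t; rewrite scalerDl.
Qed.

Lemma tlift_tcls t : tlift fP (tcls t) = tteval t.
Proof. exact/tteval_cong/tcong_repr. Qed.

Lemma tlift_linear : linear (tlift fP).
Proof.
move=> a; elim/tclsW=> s; elim/tclsW=> t.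
by rewrite -tclsZ -tclsD !tlift_tcls.
Qed.

HB.instance Definition _ := GRing.isLinear.Build F tensor U *:%R (tlift fP)
  tlift_linear.

Lemma tliftE v w : tlift fP (tpure v w) = f v w.
Proof. exact: tlift_tcls. Qed.

Lemma tlift_unique (h : {linear tensor -> U}) :
  (forall v w, h (tpure v w) = f v w) -> h =1 tlift fP.
Proof.
move=> hf; elim/tensor_ind=> [v w|x y hx hy|a x hx].
- by rewrite hf tliftE.
- by rewrite !linearD hx hy.
- by rewrite !linearZ /= hx.
Qed.
End Lift.

End Tensor.

Arguments tpure {F V W} v w.
Notation "v ⊗ w" := (tpure v w) (at level 40, left associativity) : ring_scope.

Section TensorMap.
Variables (F : fieldType) (V W V' W' : lmodType F).
Variables (f : {linear V -> V'}) (g : {linear W -> W'}).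

Lemma tmap_bilin : bilin (fun v w => f v ⊗ g w).
Proof.
by split=> [w a v v'|v a w w']; rewrite linearP ?tpureDl ?tpureZl ?tpureDr ?tpureZr.
Qed.

Definition tmap : tensor V W -> tensor V' W' := tlift tmap_bilin.
HB.instance Definition _ := GRing.Linear.on tmap.

Lemma tmapE v w : tmap (v ⊗ w) = f v ⊗ g w.
Proof. exact: tliftE. Qed.
End TensorMap.

(* The product of [tensor A B] is only declared as a possibly trivial ring (next
   to its module structure): [algType] would require a proof that 1 != 0. *)
Section TensorAlgebra.
Variables (F : fieldType) (A B : algType F).

Lemma tmul_bilin_in (a : A) (b : B) : bilin (fun a' b' => (a * a') ⊗ (b * b')).
Proof.
by split=> [w c v v'|v c w w']; rewrite mulrDr -scalerAr ?tpureDl ?tpureZl ?tpureDr ?tpureZr.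
Qed.

Lemma tmul_bilin (y : tensor A B) :
  bilin (fun a b => tlift (tmul_bilin_in a b) y).
Proof.
split=> [b c a a'|a c b b']; elim/tensor_ind: y => [v w|x y hx hy|d x hx];
  rewrite ?linearD ?linearZ ?tliftE /=.
- by rewrite mulrDl -scalerAl tpureDl tpureZl.
- by rewrite hx hy addrACA.
- by rewrite hx scalerDr !scalerA mulrC.
- by rewrite mulrDl -scalerAl tpureDr tpureZr.
- by rewrite hx hy addrACA.
- by rewrite hx scalerDr !scalerA mulrC.
Qed.

Definition tmul (x y : tensor A B) : tensor A B := tlift (tmul_bilin y) x.

Lemma tmul_pure a b a' b' : tmul (a ⊗ b) (a' ⊗ b') = (a * a') ⊗ (b * b').
Proof. by rewrite /tmul !tliftE. Qed.

Lemma tmulDl : left_distributive tmul +%R.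
Proof. by move=> x y z; rewrite /tmul linearD. Qed.
Lemma tmulZl c x y : tmul (c *: x) y = c *: tmul x y.
Proof. by rewrite /tmul linearZ. Qed.
Lemma tmulDr : right_distributive tmul +%R.
Proof.
move=> x y z; elim/tensor_ind: x => [v w|x x' hx hx'|d x hx].
- by rewrite /tmul !tliftE linearD.
- by rewrite !tmulDl hx hx' addrACA.
- by rewrite !tmulZl hx scalerDr.
Qed.
Lemma tmulZr c x y : tmul x (c *: y) = c *: tmul x y.
Proof.
elim/tensor_ind: x => [v w|x x' hx hx'|d x hx].
- by rewrite /tmul !tliftE linearZ.
- by rewrite !tmulDl hx hx' scalerDr.
- by rewrite !tmulZl hx !scalerA mulrC.
Qed.

Lemma tmulA : associative tmul.
Proof.
elim/tensor_ind=> [a b|x x' hx hx'|c x hx] y z; last 2 first.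
- by rewrite !tmulDl hx hx'.
- by rewrite !tmulZl hx.
elim/tensor_ind: y => [a' b'|y y' hy hy'|c y hy]; last 2 first.
- by rewrite !(tmulDl, tmulDr) hy hy'.
- by rewrite !(tmulZl, tmulZr) hy.
elim/tensor_ind: z => [a'' b''|z z' hz hz'|c z hz]; last 2 first.
- by rewrite !tmulDr hz hz'.
- by rewrite !tmulZr hz.
by rewrite !tmul_pure !mulrA.
Qed.
Lemma tmul1 : left_id (1 ⊗ 1) tmul.
Proof.
elim/tensor_ind=> [a b|x y hx hy|c x hx].
- by rewrite tmul_pure !mul1r.
- by rewrite tmulDr hx hy.
- by rewrite tmulZr hx.
Qed.
Lemma tmulr1 : right_id (1 ⊗ 1) tmul.
Proof.
elim/tensor_ind=> [a b|x y hx hy|c x hx].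
- by rewrite tmul_pure !mulr1.
- by rewrite tmulDl hx hy.
- by rewrite tmulZl hx.
Qed.

HB.instance Definition _ :=
  GRing.Zmodule_isPzRing.Build (tensor A B) tmulA tmul1 tmulr1 tmulDl tmulDr.

Lemma tpureM (a a' : A) (b b' : B) : (a ⊗ b) * (a' ⊗ b') = (a * a') ⊗ (b * b').
Proof. exact: tmul_pure. Qed.
Lemma tpure11 : (1 : A) ⊗ (1 : B) = 1. Proof. by []. Qed.
Lemma tensorZAl c (x y : tensor A B) : c *: (x * y) = (c *: x) * y.
Proof. by rewrite -[RHS]/(tmul _ _) tmulZl. Qed.
Lemma tensorZAr c (x y : tensor A B) : c *: (x * y) = x * (c *: y).
Proof. by rewrite -[RHS]/(tmul _ _) tmulZr. Qed.
End TensorAlgebra.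

Section Trilinear.
Variables (F : fieldType) (V1 V2 V3 U : lmodType F) (f : V1 -> V2 -> V3 -> U).

Definition trilin : Prop :=
  [/\ forall v2 v3, linear (fun v1 => f v1 v2 v3),
      forall v1 v3, linear (fun v2 => f v1 v2 v3)
    & forall v1 v2, linear (f v1 v2)].

Hypothesis fP : trilin.

Lemma trilin_in v3 : bilin (fun v1 v2 => f v1 v2 v3).
Proof. by have [f1 f2 _] := fP; split. Qed.

Lemma trilin_out : bilin (fun x v3 => tlift (trilin_in v3) x).
Proof.
have [_ _ f3] := fP; split=> [v3|x]; first exact: (tlift_linear (trilin_in v3)).
elim/tensor_ind: x => [v w|x y hx hy|d x hx] a u u'.
- by rewrite /= !tliftE f3.
- move: (hx a u u') (hy a u u') => /= ex ey.
  by rewrite !linearD /= ex ey addrACA.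
- move: (hx a u u') => /= ex.
  by rewrite !linearZ /= ex scalerDr !scalerA mulrC.
Qed.

Definition tlift3 : tensor (tensor V1 V2) V3 -> U := tlift trilin_out.
HB.instance Definition _ := GRing.Linear.on tlift3.

Lemma tlift3E v1 v2 v3 : tlift3 (v1 ⊗ v2 ⊗ v3) = f v1 v2 v3.
Proof. by rewrite /tlift3 !tliftE. Qed.
End Trilinear.

Section Hopf.
Variables (F : fieldType).

Lemma tassoc_trilin (V1 V2 V3 : lmodType F) :
  trilin (fun (v1 : V1) (v2 : V2) (v3 : V3) => v1 ⊗ (v2 ⊗ v3)).
Proof.
by split=> [u v|u v|u v] a w w'; rewrite ?(tpureDl, tpureDr, tpureZl, tpureZr).
Qed.
Definition tassoc (V1 V2 V3 : lmodType F) := tlift3 (tassoc_trilin V1 V2 V3).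

Lemma counitl_bilin (A : algType F) (e : {linear A -> F^o}) :
  bilin (fun a b : A => e a *: b).
Proof.
by split=> [u|u] a v w; rewrite ?linearP ?scalerDl ?scalerDr !scalerA // mulrC.
Qed.
Lemma counitr_bilin (A : algType F) (e : {linear A -> F^o}) :
  bilin (fun a b : A => e b *: a).
Proof.
by split=> [u|u] a v w; rewrite ?linearP ?scalerDl ?scalerDr !scalerA // mulrC.
Qed.

Record bialgebra (A : algType F) := Bialgebra {
  comul : {lrmorphism A -> tensor A A};
  counit : {lrmorphism A -> F^o};
  comulA : forall a,
    tassoc (tmap comul idfun (comul a)) = tmap idfun comul (comul a);
  counitL : forall a, tlift (counitl_bilin counit) (comul a) = a;
  counitR : forall a, tlift (counitr_bilin counit) (comul a) = a
}.

Lemma antipodel_bilin (A : algType F) (S : {linear A -> A}) :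
  bilin (fun a b : A => S a * b).
Proof.
by split=> [u|u] a v w; rewrite ?linearP ?mulrDl ?mulrDr -?scalerAl -?scalerAr.
Qed.
Lemma antipoder_bilin (A : algType F) (S : {linear A -> A}) :
  bilin (fun a b : A => a * S b).
Proof.
by split=> [u|u] a v w; rewrite ?linearP ?mulrDl ?mulrDr -?scalerAl -?scalerAr.
Qed.

(* The antipode is the (unique) convolution inverse of the identity. *)
Record hopfAlgebra (A : algType F) := HopfAlgebra {
  hopf_bialgebra :> bialgebra A;
  antipode : {linear A -> A};
  antipodeL : forall a,
    tlift (antipodel_bilin antipode) (comul hopf_bialgebra a) =
    (counit hopf_bialgebra a : F)%:A;
  antipodeR : forall a,
    tlift (antipoder_bilin antipode) (comul hopf_bialgebra a) =
    (counit hopf_bialgebra a : F)%:A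
}.
End Hopf.

Section QuantumMatrices.
Variables (F : fieldType) (N : nat) (q : F).

Local Notation X i j := (Gen (i, j)).

Inductive Mq_rel :
  aterm F ('I_N * 'I_N) -> aterm F ('I_N * 'I_N) -> Prop :=
| Mq_row (i j l : 'I_N) : (j < l)%N ->
    Mq_rel (X i j * X i l) (Cst q * (X i l * X i j))
| Mq_col (i j k : 'I_N) : (i < k)%N ->
    Mq_rel (X i j * X k j) (Cst q * (X k j * X i j))
| Mq_anti (i j k l : 'I_N) : (i < k)%N -> (j < l)%N ->
    Mq_rel (X i l * X k j) (X k j * X i l)
| Mq_diag (i j k l : 'I_N) : (i < k)%N -> (j < l)%N ->
    Mq_rel (X i j * X k l - X k l * X i j)
           (Cst (q - q^-1)%R * (X i l * X k j)).

Lemma Mq_rel_diag (B : algType F) (g : 'I_N * 'I_N -> B) :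
  (forall i j, i != j -> g (i, j) = 0) ->
  (forall i j, g (i, i) * g (j, j) = g (j, j) * g (i, i)) ->
  forall s t, Mq_rel s t -> teval g s = teval g t.
Proof.
move=> g0 gC s t.
have neq (a b : 'I_N) : (a < b)%N -> a != b.
  by move=> ab; apply/eqP => abE; rewrite abE ltnn in ab.
have row0 (i j l : 'I_N) : j != l -> g (i, j) * g (i, l) = 0.
  have [->|/g0->] := eqVneq i j; last by rewrite mul0r.
  by move=> /g0->; rewrite mulr0.
have col0 (i j k : 'I_N) : i != k -> g (i, j) * g (k, j) = 0.
  have [->|/g0->] := eqVneq i j; last by rewrite mul0r.
  by rewrite eq_sym => /g0->; rewrite mulr0.
have anti0 (i j k l : 'I_N) : (i < k)%N -> (j < l)%N -> g (i, l) * g (k, j) = 0.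
  move=> ik jl; have [il|/g0->] := eqVneq i l; last by rewrite mul0r.
  have [kj|/g0->] := eqVneq k j; last by rewrite mulr0.
  by move: jl; rewrite -il -kj ltnNge (ltnW ik).
case=> [i j l /neq jl|i j k /neq ik|i j k l ik jl|i j k l ik jl] /=.
- by rewrite !row0 ?mulr0 // eq_sym.
- by rewrite !col0 ?mulr0 // eq_sym.
- rewrite anti0 //; have [kj|/g0->] := eqVneq k j; last by rewrite mul0r.
  have [il|/g0->] := eqVneq i l; last by rewrite mulr0.
  by move: jl; rewrite -il -kj ltnNge (ltnW ik).
- rewrite (anti0 i j k l) // mulr0 scaleN1r mulN1r; apply/eqP; rewrite subr_eq0; apply/eqP.
  have [<-|/g0->] := eqVneq i j; last by rewrite mul0r mulr0.
  by have [<-|/g0->] := eqVneq k l; last by rewrite mul0r mulr0.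
Qed.

Definition OMq := presAlg Mq_rel.

Lemma ev_matrix_rel (xi : 'M[F]_N) : is_diag_mx xi ->
  forall s t, Mq_rel s t ->
  teval (fun p => xi p.1 p.2 : F^o) s = teval (fun p => xi p.1 p.2 : F^o) t.
Proof.
move=> /is_diag_mxP xid; apply: Mq_rel_diag => [i j ij|i j] /=.
  exact: xid.
by rewrite mulrC.
Qed.

HB.instance Definition _ := GRing.PzRing.on OMq.
HB.instance Definition _ := GRing.Lmodule.on OMq.
HB.instance Definition _ := GRing.PzSemiRing_isNonZero.Build OMq
  (pres_neq0 (ev_matrix_rel (scalar_mx_is_diag N 1))).
HB.instance Definition _ :=
  GRing.Lmodule_isLalgebra.Build F OMq (@presZAl _ _ Mq_rel).
HB.instance Definition _ :=
  GRing.Lalgebra_isAlgebra.Build F OMq (@presZAr _ _ Mq_rel).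

Definition xM (i j : 'I_N) : OMq := cls Mq_rel (X i j).

Section Evaluation.
Variables (xi : 'M[F]_N) (xi_diag : is_diag_mx xi).

Definition ev : OMq -> F^o := pres_lift (ev_matrix_rel xi_diag).
HB.instance Definition _ := GRing.isLinear.Build F OMq F^o *:%R ev
  (pres_lift_linear (ev_matrix_rel xi_diag)).
HB.instance Definition _ := GRing.isMonoidMorphism.Build OMq F^o ev
  (pres_lift_monoid (ev_matrix_rel xi_diag)).

Lemma evE i j : ev (xM i j) = xi i j.
Proof. by rewrite /ev /xM pres_lift_cls. Qed.
End Evaluation.

Definition inversions (s : 'S_N) : nat :=
  #|[set p : 'I_N * 'I_N | (p.1 < p.2)%N && (s p.2 < s p.1)%N]|.

Definition qdet : OMq :=
  \sum_(s : 'S_N) (- q) ^+ inversions s *: \prod_(i < N) xM i (s i).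

Lemma inversions1 : inversions 1%g = 0%N.
Proof.
apply/eqP; rewrite cards_eq0; apply/eqP/setP => p; rewrite !inE !permE.
by case: ltngtP.
Qed.

Lemma qdet_diag (B : algType F) (f : {lrmorphism OMq -> B}) :
  (forall i j, i != j -> f (xM i j) = 0) ->
  f qdet = \prod_(i < N) f (xM i i).
Proof.
move=> f0; rewrite /qdet linear_sum (bigD1 (1%g : 'S_N)) //= linearZ /= inversions1.
rewrite expr0 scale1r rmorph_prod /=.
rewrite [Z in _ + Z = _]big1 ?addr0 => [|s sn1].
  by apply: eq_bigr => i _; rewrite perm1.
rewrite linearZ /= rmorph_prod /=.
have [i si] : exists i, i != s i.
  apply/existsP; rewrite -negb_forall; apply: contra sn1 => /forallP sid.
  by apply/eqP/permP => i; rewrite perm1; move/eqP: (sid i) => <-.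
apply/eqP; rewrite scaler_eq0; apply/orP; right; apply/eqP.
have : i \in index_enum 'I_N by rewrite mem_index_enum.
elim: (index_enum _) => //= k r IHr; rewrite inE big_cons.
by case/predU1P=> [<-|/IHr->]; rewrite ?mulr0 // f0 ?mul0r.
Qed.

End QuantumMatrices.

Arguments xM {F N q} i j.
Arguments ev {F N} q {xi} xi_diag _.

Section Localization.
Variables (F : fieldType) (A : algType F) (d : A).

(* The localization is the algebra obtained from [A] by universally adjoining a
   two-sided inverse of [d]; it is A[d^-1] when [d] is central.
   Generators: the elements [a] of [A], as [Some a], and the inverse of [d], as
   [None]. *)
Inductive loc_rel : aterm F (option A) -> aterm F (option A) -> Prop :=
| loc_cst c : loc_rel (Gen (Some c%:A)) (Cst c)
| loc_add a b : loc_rel (Gen (Some (a + b)%R)) (Gen (Some a) + Gen (Some b))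
| loc_mul a b : loc_rel (Gen (Some (a * b)%R)) (Gen (Some a) * Gen (Some b))
| loc_invr : loc_rel (Gen (Some d) * Gen None) (Cst 1%R)
| loc_invl : loc_rel (Gen None * Gen (Some d)) (Cst 1%R).

Definition locAlg := presAlg loc_rel.

Definition loc_in (a : A) : locAlg := cls loc_rel (Gen (Some a)).

Lemma loc_relP s t : loc_rel s t -> cls loc_rel s = cls loc_rel t.
Proof. by move=> st; apply/clsP; exact: cong_rel. Qed.

Lemma loc_in_monoid : monoid_morphism loc_in.
Proof.
split; last by move=> a b; rewrite -clsM; exact/loc_relP/loc_mul.
by rewrite -cls1 -(loc_relP (loc_cst 1)) scale1r.
Qed.

Lemma loc_in_linear : linear loc_in.
Proof.
move=> c a b; rewrite [LHS](loc_relP (loc_add _ _)) clsD; congr (_ + _).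
rewrite -[c *: a]mulr_algl [LHS](loc_relP (loc_mul _ _)) clsM presZ.
by rewrite (loc_relP (loc_cst c)).
Qed.

Section Lift.
Variables (B : algType F) (f : {lrmorphism A -> B}) (e : B).
Hypotheses (fe : f d * e = 1) (ef : e * f d = 1).

Definition loc_gen (o : option A) : B := if o is Some a then f a else e.

Lemma loc_genP s t : loc_rel s t -> teval loc_gen s = teval loc_gen t.
Proof.
case=> [c|a b|a b||] /=.
- by rewrite linearZ /= rmorph1.
- by rewrite linearD.
- by rewrite rmorphM.
- by rewrite scale1r.
- by rewrite scale1r.
Qed.
End Lift.
End Localization.

Section QuantumGL.
Variables (F : fieldType) (N : nat) (q : F).

Definition OGLq := locAlg (@qdet F N q).

Lemma ev1_qdet : ev q (scalar_mx_is_diag N (1 : F)) (qdet N q) = 1.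
Proof.
rewrite qdet_diag => [|i j ij] /=.
  by rewrite big1 // => i _; rewrite evE mxE eqxx.
by rewrite evE mxE (negPf ij).
Qed.

Lemma OGLq_neq0 : (1 : OGLq) != 0.
Proof.
pose f := ev q (scalar_mx_is_diag N (1 : F)).
have f1 : f (qdet N q) * (1 : F^o) = 1 by rewrite mulr1 /f ev1_qdet.
have f2 : (1 : F^o) * f (qdet N q) = 1 by rewrite mul1r /f ev1_qdet.
exact: pres_neq0 (loc_genP f1 f2).
Qed.

HB.instance Definition _ := GRing.PzRing.on OGLq.
HB.instance Definition _ := GRing.Lmodule.on OGLq.
HB.instance Definition _ := GRing.PzSemiRing_isNonZero.Build OGLq OGLq_neq0.
HB.instance Definition _ := GRing.Lmodule_isLalgebra.Build F OGLq
  (@presZAl _ _ (loc_rel (qdet N q))).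
HB.instance Definition _ := GRing.Lalgebra_isAlgebra.Build F OGLq
  (@presZAr _ _ (loc_rel (qdet N q))).

Definition toGL (h : OMq N q) : OGLq := loc_in (qdet N q) h.
HB.instance Definition _ := GRing.isLinear.Build F (OMq N q) OGLq *:%R toGL
  (loc_in_linear (qdet N q)).
HB.instance Definition _ := GRing.isMonoidMorphism.Build (OMq N q) OGLq toGL
  (loc_in_monoid (qdet N q)).

Definition xGL (i j : 'I_N) : OGLq := toGL (xM i j).

(* Laurent polynomials: the generator [(i, b)] is [t_i] if [b] is [true] and
   [t_i^-1] otherwise. *)
Inductive torus_rel :
  aterm F ('I_N * bool) -> aterm F ('I_N * bool) -> Prop :=
| torus_comm a b : torus_rel (Gen a * Gen b) (Gen b * Gen a)
| torus_inv i : torus_rel (Gen (i, true) * Gen (i, false)) (Cst 1%R).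

Definition OD := presAlg torus_rel.

Lemma torus_one s t : torus_rel s t ->
  teval (fun=> 1 : F^o) s = teval (fun=> 1 : F^o) t.
Proof. by case=> //= i; rewrite mulr1 scale1r. Qed.

HB.instance Definition _ := GRing.PzRing.on OD.
HB.instance Definition _ := GRing.Lmodule.on OD.
HB.instance Definition _ :=
  GRing.PzSemiRing_isNonZero.Build OD (pres_neq0 torus_one).
HB.instance Definition _ :=
  GRing.Lmodule_isLalgebra.Build F OD (@presZAl _ _ torus_rel).
HB.instance Definition _ :=
  GRing.Lalgebra_isAlgebra.Build F OD (@presZAr _ _ torus_rel).

Definition tD (i : 'I_N) : OD := cls torus_rel (Gen (i, true)).
Definition tDinv (i : 'I_N) : OD := cls torus_rel (Gen (i, false)).

Lemma OD_mulC (x y : OD) : x * y = y * x.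
Proof.
have genC a : forall y : OD, cls torus_rel (Gen a) * y = y * cls torus_rel (Gen a).
  elim/clsW; elim=> [b|c|s IHs t IHt|s IHs t IHt].
  - by rewrite -!clsM; apply/clsP/cong_rel/torus_comm.
  - by rewrite cls_cst -presZAr -presZAl mulr1 mul1r.
  - by rewrite clsD mulrDl mulrDr IHs IHt.
  - by rewrite clsM mulrA IHs -mulrA IHt mulrA.
elim/clsW: x; elim=> [b|c|s IHs t IHt|s IHs t IHt] //.
- by rewrite cls_cst -presZAr -presZAl mulr1 mul1r.
- by rewrite clsD mulrDl mulrDr IHs IHt.
- by rewrite clsM -mulrA IHt mulrA IHs mulrA.
Qed.
HB.instance Definition _ := GRing.PzRing_hasCommutativeMul.Build OD OD_mulC.

Lemma tDK i : tD i * tDinv i = 1.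
Proof. by rewrite -clsM -cls1; apply/clsP/cong_rel/torus_inv. Qed.

Definition piM_gen (p : 'I_N * 'I_N) : OD := if p.1 == p.2 then tD p.1 else 0.

Lemma piM_rel s t : Mq_rel q s t -> teval piM_gen s = teval piM_gen t.
Proof.
apply: Mq_rel_diag => [i j /negPf ij|i j]; first by rewrite /piM_gen /= ij.
by rewrite mulrC.
Qed.

Definition piM : OMq N q -> OD := pres_lift piM_rel.
HB.instance Definition _ := GRing.isLinear.Build F (OMq N q) OD *:%R piM
  (pres_lift_linear piM_rel).
HB.instance Definition _ := GRing.isMonoidMorphism.Build (OMq N q) OD piM
  (pres_lift_monoid piM_rel).

Lemma piME i j : piM (xM i j) = if i == j then tD i else 0.
Proof. by rewrite /piM /xM pres_lift_cls. Qed.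

Lemma piM_qdet : piM (qdet N q) * \prod_i tDinv i = 1.
Proof.
rewrite qdet_diag => [|i j /negPf ij] /=; last by rewrite piME ij.
by rewrite -big_split big1 //= => i _; rewrite piME eqxx tDK.
Qed.
Lemma piM_qdetC : (\prod_i tDinv i) * piM (qdet N q) = 1.
Proof. by rewrite mulrC piM_qdet. Qed.

Definition piD : OGLq -> OD := pres_lift (loc_genP piM_qdet piM_qdetC).
HB.instance Definition _ := GRing.isLinear.Build F OGLq OD *:%R piD
  (pres_lift_linear (loc_genP piM_qdet piM_qdetC)).
HB.instance Definition _ := GRing.isMonoidMorphism.Build OGLq OD piD
  (pres_lift_monoid (loc_genP piM_qdet piM_qdetC)).

Lemma piDE i j : piD (xGL i j) = if i == j then tD i else 0.
Proof. by rewrite /piD /xGL pres_lift_cls /= piME. Qed.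

End QuantumGL.

Arguments xGL {F N q} i j.

Section Coactions.
Variables (F : fieldType) (N : nat) (q : F).
Variables (BM : bialgebra (OMq N q)) (BG : hopfAlgebra (OGLq N q)).

Local Notation M := (OMq N q).
Local Notation GL := (OGLq N q).
Local Notation S := (antipode BG).

Lemma beta_trilin : trilin (fun h1 h2 h3 : M => h2 ⊗ (S (toGL h1) * toGL h3)).
Proof.
by split=> [u v|u v|u v] a w w'; rewrite ?linearP ?mulrDl ?mulrDr
  -?scalerAl -?scalerAr ?tpureDl ?tpureDr ?tpureZl ?tpureZr.
Qed.

Lemma alpha_trilin : trilin (fun h1 h2 h3 : M => h2 ⊗ (toGL h3 * S (toGL h1))).
Proof.
by split=> [u v|u v|u v] a w w'; rewrite ?linearP ?mulrDl ?mulrDr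
  -?scalerAl -?scalerAr ?tpureDl ?tpureDr ?tpureZl ?tpureZr.
Qed.

(* h |-> h1 ⊗ h2 ⊗ h3 *)
Definition comul2 (h : M) : tensor (tensor M M) M :=
  tmap (comul BM) idfun (comul BM h).

Definition beta (h : M) : tensor M GL := tlift3 beta_trilin (comul2 h).
Definition alpha (h : M) : tensor M GL := tlift3 alpha_trilin (comul2 h).

Lemma scale_bilin (V : lmodType F) : bilin (fun (c : F^o) (v : V) => c *: v).
Proof.
by split=> [u|u] a v w; rewrite ?scalerDl ?scalerDr !scalerA // mulrC.
Qed.

(* The canonical identification F ⊗ V = V. *)
Definition tunitl (V : lmodType F) : tensor F^o V -> V := tlift (@scale_bilin V).

Section CoOrbit.
Variables (xi : 'M[F]_N) (xi_diag : is_diag_mx xi).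

Definition beta_orbit (h : M) : GL :=
  tunitl (tmap (ev q xi_diag) idfun (beta h)).
Definition alpha_orbit (h : M) : GL :=
  tunitl (tmap (ev q xi_diag) idfun (alpha h)).
End CoOrbit.

Definition lambdaD (f : GL) : tensor (OD F N) GL :=
  tmap (@piD F N q) idfun (comul BG f).

Definition ODGLq : set GL := [set f | lambdaD f = 1 ⊗ f].

End Coactions.

(* Main.v *)
(* Work in the convolution algebra of linear maps from O(M_q) to O(D) ⊗ O(GL_q),
   writing a(h) = 1 ⊗ h, b(h) = pi_D(h) ⊗ 1, a' and b' for their composites
   with S (the convolution inverses of a and b), and e = ev_xi 1. On O(M_q) one
   has lambda_D = b * a, hence lambda_D S = a' * b' by uniqueness of inverses.
   Since xi is diagonal, e and b commute (it suffices to check generators), so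
     lambda_D beta^xi = (a' * b') * e * (b * a) = a' * e * a = 1 ⊗ beta^xi.
   For alpha^xi the same computation is done with the opposite product of
   O(D) ⊗ O(GL_q): the formulas for lambda_D persist because the values of a, a'
   commute with those of b, b', and b' remains inverse to b because O(D) is
   commutative. *)
From HB Require Import structures.
Require Import Defs.
From mathcomp Require Import all_boot all_order all_algebra.
From mathcomp Require Import boolp classical_sets reals.
From mathcomp Require Import complex.

Local Open Scope classical_set_scope.
Local Open Scope ring_scope.
Set Implicit Arguments.
Unset Strict Implicit.
Unset Printing Implicit Defensive.
Import GRing.Theory.

(** * Extensionality of linear maps, in particular on tensor products *)

Section LinearMaps.
Variables (F : fieldType).

(** The linearity proofs agree by proof irrelevance. Convolution identities can thus be equations
    between bundled maps, usable for rewriting under [conv]. *)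
Lemma linear_ext (U V : lmodType F) (f g : {linear U -> V}) : f =1 g -> f = g.
Proof.
case: f g => [f [[f1] [f2]]] [g [[g1] [g2]]] /= fg.
have {fg} fg : f = g by exact/funext.
by subst g; rewrite (Prop_irrelevance g1 f1) (Prop_irrelevance g2 f2).
Qed.

Lemma tensor_ext (V W U : lmodType F) (f g : {linear tensor V W -> U}) :
  (forall v w, f (v ⊗ w) = g (v ⊗ w)) -> f =1 g.
Proof.
move=> fg; elim/tensor_ind=> [v w|x y fx fy|a x fx]; first exact: fg.
- by rewrite !linearD fx fy.
- by rewrite !linearZ /= fx.
Qed.

Lemma tensor3_ext (V1 V2 V3 U : lmodType F)
    (f g : {linear tensor (tensor V1 V2) V3 -> U}) :
  (forall v1 v2 v3, f (v1 ⊗ v2 ⊗ v3) = g (v1 ⊗ v2 ⊗ v3)) -> f =1 g.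
Proof.
move=> fg; apply: tensor_ext => x v3.
elim/tensor_ind: x => [v1 v2|x y fx fy|a x fx]; first exact: fg.
- by rewrite tpureDl !linearD fx fy.
- by rewrite tpureZl !linearZ /= fx.
Qed.

End LinearMaps.

(* Convolution is needed for the algebra [tensor OD GL], which is only a ring
   and a module (not an [algType]), and for opposite products: hence the product
   is a parameter. *)
Record unitalProduct (F : fieldType) (T : lmodType F) := UnitalProduct {
  prod_op :> T -> T -> T;
  prod_one : T;
  prod_bilin : bilin prod_op;
  prod_opA : associative prod_op;
  prod_1op : left_id prod_one prod_op;
  prod_op1 : right_id prod_one prod_op
}.

(** * Opposite products and the products of algebras and tensor products *)

Section UnitalProducts.
Variables (F : fieldType).

Section Basics.
Variables (T : lmodType F) (m : unitalProduct T).

Lemma prodDl x y z : m (x + y) z = m x z + m y z.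
Proof. by have [/(_ z 1 x y)] := prod_bilin m; rewrite !scale1r. Qed.
Lemma prodDr x y z : m x (y + z) = m x y + m x z.
Proof. by have [_ /(_ x 1 y z)] := prod_bilin m; rewrite !scale1r. Qed.
Lemma prod0l z : m 0 z = 0.
Proof. by apply: (addrI (m 0 z)); rewrite -prodDl !addr0. Qed.
Lemma prod0r z : m z 0 = 0.
Proof. by apply: (addrI (m z 0)); rewrite -prodDr !addr0. Qed.
Lemma prodZl a x y : m (a *: x) y = a *: m x y.
Proof. by have [/(_ y a x 0)] := prod_bilin m; rewrite prod0l !addr0. Qed.
Lemma prodZr a x y : m x (a *: y) = a *: m x y.
Proof. by have [_ /(_ x a y 0)] := prod_bilin m; rewrite prod0r !addr0. Qed.

Lemma opp_prod_bilin : bilin (fun x y => m y x).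
Proof. by have [ml mr] := prod_bilin m; split. Qed.
Lemma opp_prodA : associative (fun x y => m y x).
Proof. by move=> x y z; rewrite prod_opA. Qed.

Definition opp_prod : unitalProduct T :=
  UnitalProduct opp_prod_bilin opp_prodA (prod_op1 m) (prod_1op m).
End Basics.

Lemma alg_prod_bilin (A : algType F) : bilin ( *%R : A -> A -> A).
Proof.
by split=> [z a x y|x a y z]; rewrite ?mulrDl ?mulrDr -?scalerAl -?scalerAr.
Qed.
Definition alg_prod (A : algType F) : unitalProduct A :=
  UnitalProduct (@alg_prod_bilin A) (@mulrA A) (@mul1r A) (@mulr1 A).

Lemma tensor_prod_bilin (A B : algType F) :
  bilin ( *%R : tensor A B -> tensor A B -> tensor A B).
Proof.
by split=> [z a x y|x a y z]; rewrite ?mulrDl ?mulrDr -?tensorZAl -?tensorZAr.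
Qed.
Definition tensor_prod (A B : algType F) : unitalProduct (tensor A B) :=
  UnitalProduct (@tensor_prod_bilin A B) (@mulrA (tensor A B))
    (@mul1r (tensor A B)) (@mulr1 (tensor A B)).

End UnitalProducts.

(** * The convolution algebra of linear maps on a bialgebra *)

Section Convolution.
Variables (F : fieldType) (A : algType F) (BA : bialgebra A).

(* Restated because the type of [comul] hides the ring structure of [tensor A A]
   behind a reverse coercion, where rewriting with [tpureM] does not find it. *)
Lemma comul_mul x y :
  comul BA (x * y) = (comul BA x : tensor A A) * (comul BA y : tensor A A).
Proof. exact: rmorphM. Qed.

Lemma comul_1 : comul BA 1 = (1 : A) ⊗ (1 : A).
Proof. exact: rmorph1. Qed.

Section Product.
Variables (T : lmodType F) (m : unitalProduct T).
Implicit Types f g k : {linear A -> T}.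

Lemma conv_bilin f g : bilin (fun x y => m (f x) (g y)).
Proof.
by split=> [z a x y|x a y z];
  rewrite linearP ?prodDl ?prodDr ?prodZl ?prodZr.
Qed.

Definition conv f g : {linear A -> T} := tlift (conv_bilin f g) \o comul BA.

(** A functional followed by the unit of [m]: this places the counit and [ev] in the convolution
    algebra. *)
Definition scalar_map (e : {linear A -> F^o}) (x : A) : T := e x *: prod_one m.
Lemma scalar_map_linear e : linear (scalar_map e).
Proof. by move=> a x y; rewrite /scalar_map linearP scalerDl scalerA. Qed.
HB.instance Definition _ e :=
  GRing.isLinear.Build F A T *:%R (scalar_map e) (scalar_map_linear e).

Definition conv1 : {linear A -> T} := scalar_map (counit BA).

Lemma conv_trilin f g k : trilin (fun x y z => m (m (f x) (g y)) (k z)).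
Proof.
split=> y z a u v;
  by rewrite !linearP ?(prodDl, prodDr, prodZl, prodZr).
Qed.

(** Bracketing to the left matches [comul2], through which the coactions are defined. *)
Lemma conv3E f g k x :
  conv (conv f g) k x =
  tlift3 (conv_trilin f g k) (tmap (comul BA) idfun (comul BA x)).
Proof.
rewrite /conv /=; move: (comul BA x).
(* Both sides are linear in the comultiplication of [x]; the explicit composite exhibits the right
   one as a linear map. *)
apply: (@tensor_ext _ _ _ _ _ (tlift3 _ \o tmap _ _)) => v w /=.
rewrite tliftE tmapE /=; move: (comul BA v) => z.
elim/tensor_ind: z => [y z|y z Hy Hz|a y Hy].
- by rewrite tliftE tlift3E.
- by rewrite linearD prodDl Hy Hz tpureDl linearD.
- by rewrite linearZ prodZl Hy tpureZl linearZ.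
Qed.

Lemma convA f g k : conv f (conv g k) = conv (conv f g) k.
Proof.
apply: linear_ext => x; rewrite conv3E.
have outer : bilin (fun u z => m (f u) (tlift (conv_bilin g k) z)).
  by split=> [z a u v|u a z w]; rewrite linearP ?prodDl ?prodDr ?prodZl ?prodZr.
transitivity (tlift outer (tmap idfun (comul BA) (comul BA x))).
  rewrite /conv /=; move: (comul BA x).
  apply: (@tensor_ext _ _ _ _ _ (tlift _ \o tmap _ _)) => u v /=.
  by rewrite tmapE !tliftE.
(* Coassociativity leaves only the associativity of [m] on pure tensors. *)
rewrite -comulA; move: (tmap _ _ _).
apply: (@tensor3_ext _ _ _ _ _ (tlift outer \o @tassoc _ _ _ _)) => u v w /=.
by rewrite /tassoc !tlift3E !tliftE prod_opA.
Qed.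

Lemma conv1l f : conv conv1 f = f.
Proof.
apply: linear_ext => x; rewrite -[in RHS](counitL BA x) /conv /=.
move: (comul BA x); apply: (@tensor_ext _ _ _ _ _ (f \o tlift _)) => u v /=.
by rewrite !tliftE prodZl prod_1op linearZ.
Qed.

Lemma conv1r f : conv f conv1 = f.
Proof.
apply: linear_ext => x; rewrite -[in RHS](counitR BA x) /conv /=.
move: (comul BA x); apply: (@tensor_ext _ _ _ _ _ (f \o tlift _)) => u v /=.
by rewrite !tliftE prodZr prod_op1 linearZ.
Qed.

(** [f = f * (g * k) = (f * g) * k = k]. *)
Lemma conv_inverse_unique f g k : conv f g = conv1 -> conv g k = conv1 -> f = k.
Proof. by move=> fg gk; rewrite -[f]conv1r -gk convA fg conv1l. Qed.

(** The commutation hypothesis interchanges the two middle factors of [f u * f u' * g v * g v'].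
    Identities between such convolutions then reduce to generators. *)
Lemma conv_mult f g :
  (forall x y, f (x * y) = m (f x) (f y)) ->
  (forall x y, g (x * y) = m (g x) (g y)) ->
  (forall x y, m (f x) (g y) = m (g y) (f x)) ->
  forall x y, conv f g (x * y) = m (conv f g x) (conv f g y).
Proof.
move=> fM gM fgC x y; rewrite /conv /= comul_mul.
move: (comul BA x) (comul BA y) => X Y.
elim/tensor_ind: X => [u v|X X' HX HX'|a X HX].
- elim/tensor_ind: Y => [u' v'|Y Y' HY HY'|a Y HY].
  + rewrite tpureM !tliftE fM gM !prod_opA; congr (m _ _).
    by rewrite -!prod_opA fgC.
  + by rewrite mulrDr !linearD /= HY HY' prodDr.
  + by rewrite -tensorZAr !linearZ /= HY prodZr.
- by rewrite mulrDl !linearD /= HX HX' prodDl.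
- by rewrite -tensorZAl !linearZ /= HX prodZl.
Qed.
End Product.

Lemma conv_comp (T T' : lmodType F) (m : unitalProduct T) (m' : unitalProduct T')
    (phi : {linear T -> T'}) (f g : {linear A -> T}) :
  (forall x y, phi (m x y) = m' (phi x) (phi y)) ->
  forall x, phi (conv m f g x) = conv m' (phi \o f) (phi \o g) x.
Proof.
move=> phiM x; rewrite /conv /=; move: (comul BA x).
apply: (@tensor_ext _ _ _ _ (phi \o tlift _)) => u v /=.
by rewrite !tliftE phiM.
Qed.

(** Transfers a convolution to the opposite product when the values of [f] and [g] commute. *)
Lemma eq_conv (T : lmodType F) (m m' : unitalProduct T) (f g : {linear A -> T}) :
  (forall x y, m (f x) (g y) = m' (f x) (g y)) -> conv m f g = conv m' f g.
Proof.
move=> mm; apply: linear_ext => x; rewrite /conv /=; move: (comul BA x).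
by apply: tensor_ext => u v; rewrite /= !tliftE.
Qed.

End Convolution.

(** * The embeddings of the two factors into a tensor product of algebras *)

Section TensorUnits.
Variables (F : fieldType) (A B : algType F).

Definition tensor_inl (a : A) : tensor A B := a ⊗ 1.
Definition tensor_inr (b : B) : tensor A B := 1 ⊗ b.
HB.instance Definition _ := GRing.isLinear.Build F A (tensor A B) *:%R tensor_inl
  ((tpure_bilin A B).1 1).
HB.instance Definition _ := GRing.isLinear.Build F B (tensor A B) *:%R tensor_inr
  ((tpure_bilin A B).2 1).

Lemma tensor_inlM a a' : tensor_inl (a * a') = tensor_inl a * tensor_inl a'.
Proof. by rewrite /tensor_inl tpureM mulr1. Qed.
Lemma tensor_inrM b b' : tensor_inr (b * b') = tensor_inr b * tensor_inr b'.
Proof. by rewrite /tensor_inr tpureM mulr1. Qed.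
Lemma tensor_inlr a b : tensor_inl a * tensor_inr b = a ⊗ b.
Proof. by rewrite /tensor_inl /tensor_inr tpureM mulr1 mul1r. Qed.
Lemma tensor_inrl a b : tensor_inr b * tensor_inl a = a ⊗ b.
Proof. by rewrite /tensor_inl /tensor_inr tpureM mulr1 mul1r. Qed.

Lemma tmapM (A' B' : algType F) (f : {lrmorphism A -> A'})
    (g : {lrmorphism B -> B'}) (x y : tensor A B) :
  tmap f g (x * y) = tmap f g x * tmap f g y.
Proof.
elim/tensor_ind: x => [u v|x x' Hx Hx'|a x Hx].
- elim/tensor_ind: y => [u' v'|y y' Hy Hy'|a y Hy].
  + by rewrite tpureM !tmapE tpureM !rmorphM.
  + by rewrite mulrDr !linearD /= Hy Hy' mulrDr.
  + by rewrite -tensorZAr !linearZ /= Hy -tensorZAr.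
- by rewrite mulrDl !linearD /= Hx Hx' mulrDl.
- by rewrite -tensorZAl !linearZ /= Hx -tensorZAl.
Qed.

End TensorUnits.
Arguments tensor_inl {F A} B a.
Arguments tensor_inr {F} A {B} b.

Lemma OMq_ind (F : fieldType) (N : nat) (q : F) (P : OMq N q -> Prop) :
  P 1 -> (forall i j, P (xM i j)) ->
  (forall c x y, P x -> P y -> P (c *: x + y)) ->
  (forall x y, P x -> P y -> P (x * y)) -> forall x, P x.
Proof.
move=> P1 PX PL PM; elim/clsW; elim=> [[i j]|c|s Ps t Pt|s Ps t Pt].
- exact: PX.
(* The constant [c] is [c *: 1 + 0], and [0] is [-1 *: 1 + 1]. *)
- rewrite cls_cst; have P0 : P 0.
    by have := PL (-1) 1 1 P1 P1; rewrite scaleN1r addNr.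
  by have := PL c 1 0 P1 P0; rewrite addr0.
- by have := PL 1 _ _ Ps Pt; rewrite scale1r clsD.
- by rewrite clsM; apply: PM.
Qed.

(** * Antipode and left coaction, pulled back to O(M_q) *)

Section CoOrbits.
Variables (F : fieldType) (N : nat) (q : F).
Variables (BM : bialgebra (OMq N q)) (BG : hopfAlgebra (OGLq N q)).
Hypothesis comulM : forall i j : 'I_N,
  comul BM (xM i j) = \sum_(k < N) xM i k ⊗ xM k j.
Hypothesis counitM : forall i j : 'I_N, counit BM (xM i j) = (i == j)%:R.
Hypothesis comulG : forall i j : 'I_N,
  comul BG (xGL i j) = \sum_(k < N) xGL i k ⊗ xGL k j.
Hypothesis counitG : forall i j : 'I_N, counit BG (xGL i j) = (i == j)%:R.

Local Notation M := (OMq N q).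
Local Notation GL := (OGLq N q).
Local Notation D := (OD F N).
Local Notation toGL := (@toGL F N q).
Local Notation piD := (@piD F N q).

(** Both sides are algebra homomorphisms and agree on the generators. *)
Lemma comul_toGL x : comul BG (toGL x) = tmap toGL toGL (comul BM x).
Proof.
elim/OMq_ind: x => [|i j|c x y Hx Hy|x y Hx Hy].
- by rewrite !rmorph1 -tpure11 tmapE !rmorph1.
- rewrite comulM linear_sum [LHS]comulG; apply: eq_bigr => k _.
  by rewrite /= tmapE.
- by rewrite !linearP /= Hx Hy.
- by rewrite rmorphM !comul_mul tmapM Hx Hy.
Qed.

Lemma counit_toGL x : counit BG (toGL x) = counit BM x.
Proof.
elim/OMq_ind: x => [|i j|c x y Hx Hy|x y Hx Hy].
- by rewrite !rmorph1.
- by rewrite counitM [LHS]counitG.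
- by rewrite !linearP /= Hx Hy.
- by rewrite !rmorphM /= Hx Hy.
Qed.

Definition antipodeM : {linear M -> GL} := antipode BG \o toGL.

(** The antipode axiom of O(GL_q), pulled back along the bialgebra map [toGL]. *)
Lemma antipodeM_convl :
  conv BM (alg_prod GL) antipodeM toGL = conv1 BM (alg_prod GL).
Proof.
apply: linear_ext => x; rewrite /conv1 /= /scalar_map /= -counit_toGL.
rewrite -(antipodeL BG) comul_toGL /conv /=; move: (comul BM x).
apply: (@tensor_ext _ _ _ _ _
  (tlift (antipodel_bilin (antipode BG)) \o tmap toGL toGL)) => u v /=.
by rewrite tmapE !tliftE.
Qed.

Lemma antipodeM_convr :
  conv BM (alg_prod GL) toGL antipodeM = conv1 BM (alg_prod GL).
Proof.
apply: linear_ext => x; rewrite /conv1 /= /scalar_map /= -counit_toGL.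
rewrite -(antipodeR BG) comul_toGL /conv /=; move: (comul BM x).
apply: (@tensor_ext _ _ _ _ _
  (tlift (antipoder_bilin (antipode BG)) \o tmap toGL toGL)) => u v /=.
by rewrite tmapE !tliftE.
Qed.

Definition lambda : {linear GL -> tensor D GL} := tmap piD idfun \o comul BG.

Lemma lambdaM x y : lambda (x * y) = lambda x * lambda y.
Proof. by rewrite /lambda /= comul_mul tmapM. Qed.

Lemma lambda_1 : lambda 1 = 1.
Proof. by rewrite /lambda /= comul_1 tmapE rmorph1. Qed.

(** * Convolution inverses under unital multiplicative maps *)

Section PushForward.
Variables (T : lmodType F) (m : unitalProduct T) (phi : {linear GL -> T}).
Hypothesis phiM : forall x y, phi (x * y) = m (phi x) (phi y).
Hypothesis phi1 : phi 1 = prod_one m.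

Lemma antipodeM_convl_comp :
  conv BM m (phi \o antipodeM) (phi \o toGL) = conv1 BM m.
Proof.
apply: linear_ext => x.
rewrite -(conv_comp BM (m := alg_prod GL) _ _ phiM) antipodeM_convl.
by rewrite /conv1 /= /scalar_map linearZ /= phi1.
Qed.

Lemma antipodeM_convr_comp :
  conv BM m (phi \o toGL) (phi \o antipodeM) = conv1 BM m.
Proof.
apply: linear_ext => x.
rewrite -(conv_comp BM (m := alg_prod GL) _ _ phiM) antipodeM_convr.
by rewrite /conv1 /= /scalar_map linearZ /= phi1.
Qed.
End PushForward.

(** Composed with [toGL], [piL] and [inR] give the maps b and a of the opening comment; composed
    with [antipodeM], they give b' and a'. *)
Definition piL : {linear GL -> tensor D GL} := tensor_inl GL \o piD.
Definition inR : {linear GL -> tensor D GL} := tensor_inr D.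

Lemma lambda_toGL :
  lambda \o toGL = conv BM (tensor_prod D GL) (piL \o toGL) (inR \o toGL)
  :> {linear M -> tensor D GL}.
Proof.
apply: linear_ext => x; rewrite /conv /lambda /= comul_toGL; move: (comul BM x).
apply: (@tensor_ext _ _ _ _ (tmap piD idfun \o tmap toGL toGL)) => u v /=.
by rewrite !tmapE tliftE [RHS]tensor_inlr.
Qed.

(* Both sides are convolution inverse to [lambda \o toGL]. *)
Lemma lambda_antipodeM :
  lambda \o antipodeM =
    conv BM (tensor_prod D GL) (inR \o antipodeM) (piL \o antipodeM)
  :> {linear M -> tensor D GL}.
Proof.
apply: (conv_inverse_unique (g := lambda \o toGL)).
  exact: (antipodeM_convl_comp (m := tensor_prod D GL) lambdaM lambda_1).
(* [(b * a) * (a' * b') = b * (a * a') * b' = b * b' = 1]. *)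
rewrite lambda_toGL convA -(convA _ _ _ (inR \o toGL)) antipodeM_convr_comp.
- rewrite conv1r antipodeM_convr_comp // => [x y|]; last first.
    by rewrite /piL /= rmorph1.
  by rewrite /piL /= rmorphM; exact: tensor_inlM.
- exact: tensor_inrM.
- by [].
Qed.

(** * Evaluation at a diagonal matrix and invariance of the co-orbit maps *)

Section Evaluation.
Variables (xi : 'M[F]_N) (xi_diag : is_diag_mx xi).
Local Notation ev := (ev q xi_diag).

(** Both sides are multiplicative, as O(D) is commutative. On [xM i j] they give [xi i i] and
    [xi j j] times [piD (xGL i j)]. *)
Lemma ev_conv_piD :
  conv BM (alg_prod D) (scalar_map (alg_prod D) ev) (piD \o toGL) =
  conv BM (alg_prod D) (piD \o toGL) (scalar_map (alg_prod D) ev).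
Proof.
have evM x y : scalar_map (alg_prod D) ev (x * y) =
    scalar_map (alg_prod D) ev x * scalar_map (alg_prod D) ev y.
  by rewrite /scalar_map rmorphM -scalerAl mul1r scalerA.
have piM x y : (piD \o toGL) (x * y) = (piD \o toGL) x * (piD \o toGL) y.
  by rewrite /= !rmorphM.
apply: linear_ext; elim/OMq_ind => [|i j|c x y Hx Hy|x y Hx Hy].
- by rewrite /conv /= rmorph1 -tpure11 !tliftE /= /scalar_map !rmorph1 mulrC.
- rewrite /conv /= comulM !linear_sum.
  transitivity (xi i i *: piD (xGL i j)).
    rewrite (bigD1 i) //= big1 => [|k ki]; rewrite tliftE /= /scalar_map /= evE.
      by rewrite addr0 -scalerAl mul1r.
    by rewrite (is_diag_mxP xi_diag) 1?eq_sym // scale0r mul0r.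
  rewrite (bigD1 j) //= big1 => [|k kj]; rewrite tliftE /= /scalar_map /= evE.
    rewrite addr0 -scalerAr mulr1 !piDE.
    (* Off the diagonal [piD (xGL i j)] vanishes, so [xi i i] and [xi j j] need not agree. *)
    by case: eqVneq => [->|]; rewrite ?scaler0.
  by rewrite (is_diag_mxP xi_diag) // scale0r mulr0.
- by rewrite !linearP Hx Hy.
- rewrite !conv_mult ?Hx ?Hy // => u v; exact: mulrC.
Qed.

(** The co-orbit map is the convolution of [antipodeM], [ev] and [toGL]. A general [phi] covers both
    [lambda] and [inR], the two sides of coinvariance. *)
Lemma beta_orbit_conv (T : lmodType F) (m : unitalProduct T)
    (phi : {linear GL -> T}) :
  (forall x y, phi (x * y) = m (phi x) (phi y)) ->
  forall h, phi (beta_orbit BM BG xi_diag h) =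
    conv BM m (conv BM m (phi \o antipodeM) (scalar_map m ev)) (phi \o toGL) h.
Proof.
move=> phiM h; rewrite conv3E /beta_orbit /beta /comul2.
move: (tmap _ _ (comul BM h)).
apply: (@tensor3_ext _ _ _ _ _
  (phi \o (@tunitl F GL \o (tmap ev idfun \o tlift3 (beta_trilin BG)))))
  => u v w /=.
rewrite !tlift3E tmapE /tunitl tliftE linearZ /= phiM /scalar_map.
by rewrite prodZr prodZl prod_op1.
Qed.

(** Reversing products turns [h3 S(h1)] into the order used for beta, hence the same convolution. *)
Lemma alpha_orbit_conv (T : lmodType F) (m : unitalProduct T)
    (phi : {linear GL -> T}) :
  (forall x y, phi (x * y) = m (phi y) (phi x)) ->
  forall h, phi (alpha_orbit BM BG xi_diag h) =
    conv BM m (conv BM m (phi \o antipodeM) (scalar_map m ev)) (phi \o toGL) h.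
Proof.
move=> phiM h; rewrite conv3E /alpha_orbit /alpha /comul2.
move: (tmap _ _ (comul BM h)).
apply: (@tensor3_ext _ _ _ _ _
  (phi \o (@tunitl F GL \o (tmap ev idfun \o tlift3 (alpha_trilin BG)))))
  => u v w /=.
rewrite !tlift3E tmapE /tunitl tliftE linearZ /= phiM /scalar_map.
by rewrite prodZr prodZl prod_op1.
Qed.

(* Both the product of [tensor D GL] and its opposite satisfy these hypotheses:
   the former serves [beta], the latter [alpha]. *)
Lemma coorbit_coinvariant (m : unitalProduct (tensor D GL)) :
  prod_one m = 1 ->
  (forall x y, tensor_inl GL (x * y) = m (tensor_inl GL x) (tensor_inl GL y)) ->
  (forall x y, m (tensor_inl GL x) (tensor_inr D y) = x ⊗ y) ->
  (forall x y, m (tensor_inr D y) (tensor_inl GL x) = x ⊗ y) ->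
  conv BM m (conv BM m (lambda \o antipodeM) (scalar_map m ev)) (lambda \o toGL) =
  conv BM m (conv BM m (inR \o antipodeM) (scalar_map m ev)) (inR \o toGL).
Proof.
move=> m1 inlM mlr mrl.
have -> : lambda \o toGL = conv BM m (piL \o toGL) (inR \o toGL)
    :> {linear M -> tensor D GL}.
  rewrite lambda_toGL; apply: eq_conv => x y.
  by rewrite [RHS]mlr; exact: tensor_inlr.
have -> : lambda \o antipodeM = conv BM m (inR \o antipodeM) (piL \o antipodeM)
    :> {linear M -> tensor D GL}.
  rewrite lambda_antipodeM; apply: eq_conv => x y.
  by rewrite [RHS]mrl; exact: tensor_inrl.
have evC : conv BM m (scalar_map m ev) (piL \o toGL) =
           conv BM m (piL \o toGL) (scalar_map m ev).
  (* The scalars factor through O(D), so [ev_conv_piD] can be pushed along [tensor_inl]. *)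
  have -> : scalar_map m ev = tensor_inl GL \o scalar_map (alg_prod D) ev
      :> {linear M -> tensor D GL}.
    by apply: linear_ext => x; rewrite /= /scalar_map linearZ /= m1.
  apply: linear_ext => x.
  have push f g := conv_comp BM (m := alg_prod D) f g inlM x.
  have := push (piD \o toGL) (scalar_map (alg_prod D) ev).
  have := push (scalar_map (alg_prod D) ev) (piD \o toGL).
  by rewrite ev_conv_piD => <- <-.
(* Regroup [(a' * b') * e * (b * a)] as [a' * (b' * b) * e * a]. *)
rewrite convA -(convA _ _ _ (scalar_map m ev)) evC convA.
rewrite -(convA _ _ _ (piL \o antipodeM)) antipodeM_convl_comp ?conv1r //
  => [x y|].
  by rewrite /piL /= rmorphM inlM.
by rewrite /piL /= rmorph1 m1.
Qed.

Lemma beta_coinvariant h :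
  lambdaD BG (beta_orbit BM BG xi_diag h) = 1 ⊗ beta_orbit BM BG xi_diag h.
Proof.
rewrite -[LHS]/(lambda _) (beta_orbit_conv (m := tensor_prod D GL) lambdaM).
rewrite coorbit_coinvariant //.
(* The remaining convolution is [inR] applied to the co-orbit. *)
- by rewrite -beta_orbit_conv //; exact: tensor_inrM.
- exact: tensor_inlM.
- exact: tensor_inlr.
- by move=> x y; exact: tensor_inrl.
Qed.

Lemma alpha_coinvariant h :
  lambdaD BG (alpha_orbit BM BG xi_diag h) = 1 ⊗ alpha_orbit BM BG xi_diag h.
Proof.
rewrite -[LHS]/(lambda _).
rewrite (alpha_orbit_conv (m := opp_prod (tensor_prod D GL)) lambdaM).
rewrite coorbit_coinvariant //.
- by rewrite -alpha_orbit_conv //; exact: tensor_inrM.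
(* Commutativity of O(D) makes [tensor_inl] multiplicative for the opposite product too. *)
- by move=> x y; rewrite OD_mulC; exact: tensor_inlM.
- by move=> x y; exact: tensor_inrl.
- exact: tensor_inlr.
Qed.

End Evaluation.
End CoOrbits.

Theorem proposition2p6 (R : realType) (N : nat) (hN : (1 <= N)%N)
    (q : R[i]) (hq : q != 0)
    (BM : bialgebra (OMq N q))
    (comulM : forall i j : 'I_N,
       comul BM (xM i j) = \sum_(k < N) xM i k ⊗ xM k j)
    (counitM : forall i j : 'I_N, counit BM (xM i j) = (i == j)%:R)
    (BG : hopfAlgebra (OGLq N q))
    (comulG : forall i j : 'I_N,
       comul BG (xGL i j) = \sum_(k < N) xGL i k ⊗ xGL k j)
    (counitG : forall i j : 'I_N, counit BG (xGL i j) = (i == j)%:R)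
    (xi : 'M[R[i]]_N) (xi_diag : is_diag_mx xi) :
  range (beta_orbit BM BG xi_diag) `<=` ODGLq BG /\
  range (alpha_orbit BM BG xi_diag) `<=` ODGLq BG.
Proof.
by split=> _ [h _ <-]; [exact: beta_coinvariant | exact: alpha_coinvariant].
Qed.
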